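(* Let $q\ge2$ and consider the equation $$\Delta_\infty^Nu=|Du|^qu^{1-q}\quad\text{in }\mathbb{R}^n.\qquad(\ast)$$ For each positive integer $k$, the function $u_k(x)=e^{kx_1}$, $x=(x_1,\dots,x_n)\in\mathbb{R}^n$, is a positive classical supersolution of $(\ast)$, and for every $r>0$ $$\frac{\sup_{B(0,r/3)}u_k}{\inf_{B(0,r/3)}u_k}=e^{2kr/3}.$$ Consequently, for every $r>0$ there is no constant $C>0$ such that $$\sup_{B(0,r/3)}u\le C\inf_{B(0,r/3)}u$$ for all positive supersolutions $u$ of $(\ast)$.
   Context: $B(0,r)$ is the open ball in $\mathbb{R}^n$ of radius $r$ centered at the origin. For a $C^2$ function $u$ with $Du\neq0$, $\Delta_\infty^Nu:=|Du|^{-2}\langle D^2u\,Du,Du\rangle$. A positive function $u\in C^2(\mathbb{R}^n)$ with nowhere vanishing gradient is a classical supersolution of $(\ast)$ if $\Delta_\infty^Nu\le|Du|^qu^{1-q}$ at every point of $\mathbb{R}^n$. More generally, a positive lower-semicontinuous function $u$ on $\mathbb{R}^n$ is a (viscosity) supersolution of $(\ast)$ if, whenever $\phi$ is $C^2$ near $x_0$ and $u-\phi$ has a local minimum at $x_0$, one has $\Delta_\infty^{N,-}\phi(x_0)\le|D\phi(x_0)|^qu(x_0)^{1-q}$, where $\Delta_\infty^{N,-}\phi(x_0)$ equals $|D\phi(x_0)|^{-2}\langle D^2\phi(x_0)D\phi(x_0),D\phi(x_0)\rangle$ if $D\phi(x_0)\ne0$ and $\min\{\langle D^2\phi(x_0)e,e\rangle:|e|=1\}$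 if $D\phi(x_0)=0$. *)

(* Defs.v *)
From HB Require Import structures.
From mathcomp Require Import all_boot all_order all_algebra.
From mathcomp Require Import all_classical all_reals all_analysis.

Set Implicit Arguments.
Unset Strict Implicit.
Unset Printing Implicit Defensive.

Import Order.TTheory GRing.Theory Num.Theory.
Import numFieldNormedType.Exports.

Local Open Scope classical_set_scope.
Local Open Scope ring_scope.

(* Points and vectors of R^n are row vectors.  The norm that MathComp-Analysis
   puts on 'rV[R]_n is the sup norm, so the Euclidean norm and its balls are
   defined here; the topology is the same. *)
Definition dot (R : realType) (n : nat) (u v : 'rV[R]_n) : R :=
  \sum_(i < n) u 0 i * v 0 i.

Definition enorm (R : realType) (n : nat) (v : 'rV[R]_n) : R :=
  Num.sqrt (dot v v).

Definition eball (R : realType) (n : nat) (r : R) : set 'rV[R]_n :=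
  [set x | enorm x < r].
Arguments eball {R} n r.

Definition partial (R : realType) (n : nat) (i : 'I_n) (f : 'rV[R]_n -> R) :
    'rV[R]_n -> R :=
  fun x => 'D_(delta_mx 0 i) f x.

Definition grad (R : realType) (n : nat) (f : 'rV[R]_n -> R) (x : 'rV[R]_n) :
    'rV[R]_n :=
  \row_i partial i f x.

Definition hess (R : realType) (n : nat) (f : 'rV[R]_n -> R) (x : 'rV[R]_n) :
    'M[R]_n :=
  \matrix_(i, j) partial i (partial j f) x.

(* <X v, v> *)
Definition qform (R : realType) (n : nat) (X : 'M[R]_n) (v : 'rV[R]_n) : R :=
  dot (v *m X) v.

(* f is C^2 on A; only meant for open A, since ['D_v] looks at f around each
   point and is a junk value where the directional derivative does not exist. *)
Definition C2_on (R : realType) (n : nat) (A : set 'rV[R]_n)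
    (f : 'rV[R]_n -> R) : Prop :=
  forall x, A x ->
    {for x, continuous f} /\
    (forall i, derivable f x (delta_mx 0 i) /\
               {for x, continuous (partial i f)}) /\
    (forall i j, derivable (partial j f) x (delta_mx 0 i) /\
                 {for x, continuous (partial i (partial j f))}).

Definition C2_near (R : realType) (n : nat) (x0 : 'rV[R]_n)
    (f : 'rV[R]_n -> R) : Prop :=
  exists2 U : set 'rV[R]_n, open_nbhs x0 U & C2_on U f.

(* Normalized infinity-Laplacian; used where the gradient does not vanish. *)
Definition inf_laplacian (R : realType) (n : nat) (f : 'rV[R]_n -> R)
    (x : 'rV[R]_n) : R :=
  (enorm (grad f x) ^+ 2)^-1 * qform (hess f x) (grad f x).

(* Where the gradient vanishes, the infimum is a minimum: the unit sphere is
   compact, and nonempty in dimension n >= 1. *)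
Definition inf_laplacian_lower (R : realType) (n : nat) (f : 'rV[R]_n -> R)
    (x : 'rV[R]_n) : R :=
  if grad f x != 0 then inf_laplacian f x
  else inf [set qform (hess f x) e | e in [set e : 'rV[R]_n | enorm e = 1]].

Definition classical_supersolution (R : realType) (n : nat) (q : R)
    (u : 'rV[R]_n -> R) : Prop :=
  [/\ forall x, 0 < u x,
      C2_on setT u,
      forall x, grad u x != 0
    & forall x, inf_laplacian u x <= enorm (grad u x) `^ q * u x `^ (1 - q)].

Definition local_min (R : realType) (n : nat) (f : 'rV[R]_n -> R)
    (x0 : 'rV[R]_n) : Prop :=
  \forall x \near x0, f x0 <= f x.

Definition viscosity_supersolution (R : realType) (n : nat) (q : R)
    (u : 'rV[R]_n -> R) : Prop :=
  [/\ forall x, 0 < u x,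
      lower_semicontinuous (fun x => (u x)%:E)
    & forall (phi : 'rV[R]_n -> R) (x0 : 'rV[R]_n),
        C2_near x0 phi ->
        local_min (fun x => u x - phi x) x0 ->
        inf_laplacian_lower phi x0 <=
          enorm (grad phi x0) `^ q * u x0 `^ (1 - q)].

(* Extended-real supremum and infimum: a supersolution need not be bounded
   above on a ball. *)
Definition sup_on (R : realType) (n : nat) (A : set 'rV[R]_n)
    (u : 'rV[R]_n -> R) : \bar R :=
  ereal_sup [set (u x)%:E | x in A].

Definition inf_on (R : realType) (n : nat) (A : set 'rV[R]_n)
    (u : 'rV[R]_n -> R) : \bar R :=
  ereal_inf [set (u x)%:E | x in A].

(* x |-> exp (k x_1); the dimension is n.+1 >= 1 and x_1 is the coordinate of
   index 0. *)
Definition exp_x1 (R : realType) (n : nat) (k : nat) (x : 'rV[R]_n.+1) : R :=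
  expR (k%:R * x 0 0).
Arguments exp_x1 R n k x : clear implicits.

(* Main.v *)
Require Import Defs.
From HB Require Import structures.
From mathcomp Require Import all_boot all_order all_algebra.
From mathcomp Require Import all_classical all_reals all_analysis.
From mathcomp Require Import lra.

Set Implicit Arguments.
Unset Strict Implicit.
Unset Printing Implicit Defensive.

Import Order.TTheory GRing.Theory Num.Theory.
Import numFieldNormedType.Exports.

Local Open Scope classical_set_scope.
Local Open Scope ring_scope.

(** Write [u = exp (k x_1)].  Its gradient is [k u e_1] and the only nonzero
    entry of its Hessian is [k^2 u], so the supersolution inequality reads
    [k^2 u <= (k u)^q u^(1-q) = k^q u], which holds for [k >= 1] and [q >= 2].
    On the Euclidean ball of radius [s] the coordinate [x_1] takes exactly the
    values in the open interval from [-s] to [s], so the supremum of [u] is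
    [exp (k s)], its infimum is [exp (- k s)], and their ratio [exp (2 k s)] is
    unbounded in [k]: no Harnack constant can serve all the [u].

    The constant is ruled out among viscosity supersolutions, so [u] must be
    shown to be one ([exp_x1_viscosity]).  A test function touching [u] from
    below has the same gradient as [u] at the contact point, and that gradient
    is a nonzero multiple of [e_1].  Hence the normalized infinity-Laplacian of
    the test function is just its second partial derivative in the direction
    [e_1] ([inf_laplacian_delta]), which is at most that of [u] by the
    one-variable second derivative test ([touching_from_below]). *)

(** * Second-order conditions at a local minimum *)

(** If the second derivative [c] were negative, the difference quotient of
    [df] would make [df] negative just to the right of [a], and by the mean
    value theorem [f] would drop below its minimum there.  The first derivative
    is a function [df] given near [a], so that only its differentiability at
    [a] is asked for. *)
Lemma second_derivative_test (R : realType) (f df : R -> R) (a c : R) :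
  (\forall t \near a, is_derive (t : R) (1 : R) f (df t)) -> is_derive a 1 df c ->
  (\forall t \near a, f a <= f t) -> df a = 0 /\ 0 <= c.
Proof.
move=> fdf dfc fmin.
have [e /= e0 near_a] : exists2 e, 0 < e & forall t, `|t - a| < e ->
    is_derive (t : R) (1 : R) f (df t) /\ f a <= f t.
  have /nbhs_ballP[e /= e0 ae] : nbhs a (fun t : R =>
      is_derive t 1 f (df t) /\ f a <= f t).
    exact: filterI fdf fmin.
  by exists e => // t ta; apply: ae; rewrite /ball /= distrC.
have aa : `|a - a| < e by rewrite subrr normr0.
have dfa0 : df a = 0.
  have in_ball t : t \in `]a - e, a + e[ -> `|t - a| < e.
    by rewrite in_itv /= ltr_distl.
  have [_ <-] := (near_a _ aa).1.
  suff [] : is_derive a 1 f 0 by [].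
  apply: (@derive1_at_min _ _ (a - e) (a + e)).
  - by rewrite lerD2l ge0_cp// ltW.
  - by move=> t /in_ball /near_a[[]].
  - by rewrite in_itv /= ltrBlDr ltrDl e0.
  - by move=> t /in_ball /near_a[].
split => //; rewrite leNgt; apply/negP => c0.
have [h [h0 he dfh]] : exists h, [/\ 0 < h, h < e &
    forall x, 0 < x -> x <= h -> df (x + a) < 0].
  have /cvgr_lt/(_ _ c0) : (fun h : R => h^-1 *: (df (h *: 1 + a) - df a))
      @ 0^' --> c.
    by case: dfc => d <-; exact: d.
  move=> /nbhs_ballP[d /= d0 hd].
  exists (Num.min d e / 2).
  have m0 : 0 < Num.min d e by rewrite lt_min d0.
  have m2 : Num.min d e / 2 < Num.min d e by rewrite ltr_pdivrMr// ltr_pMr// ltr1n.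
  split; first by rewrite divr_gt0.
    by rewrite (lt_le_trans m2)// ge_min lexx orbT.
  move=> x x0 xm; have := hd x.
  rewrite /ball /= sub0r normrN gtr0_norm// => /(_ _ _).
  rewrite (le_lt_trans xm) ?(lt_le_trans m2) ?ge_min ?lexx// gt_eqF//.
  move=> /(_ isT isT).
  rewrite dfa0 subr0 /GRing.scale /= mulr1 pmulr_rlt0// invr_gt0//.
have [|||x] := @MVT _ f df a (a + h).
- by rewrite ltrDl.
- move=> x; rewrite in_itv /= => /andP[ax xh].
  by apply: (near_a x _).1; rewrite gtr0_norm ?subr_gt0// ltrBlDl
    (lt_trans xh)// ltrD2l.
- apply: derivable_within_continuous => x; rewrite in_itv /= => /andP[ax xh].
  suff [] : is_derive x 1 f (df x) by [].
  by apply: (near_a x _).1; rewrite ger0_norm ?subr_ge0// ltrBlDl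
    (le_lt_trans xh)// ltrD2l.
rewrite in_itv /= => /andP[ax xh] fE.
have := (near_a (a + h) _).2.
rewrite -subr_ge0 fE addrAC subrr add0r gtr0_norm// => /(_ he).
rewrite leNgt => /negP; apply; rewrite pmulr_llt0//.
by rewrite -(subrK a x); apply: dfh; rewrite ?subr_gt0// lerBlDl ltW.
Qed.

(** * Derivatives along a line *)

(** The two difference quotients are the same function of the increment; this
    is what turns partial derivatives into derivatives in one variable. *)
Lemma is_derive_along (R : realType) (n : nat) (f : 'rV[R]_n -> R)
    (a v : 'rV[R]_n) (t d : R) :
  is_derive (t *: v + a) v f d <->
  is_derive t 1 (fun s => f (s *: v + a)) d.
Proof.
have E : (fun h : R => h^-1 *: (f (h *: v + (t *: v + a)) - f (t *: v + a))) =
   (fun h : R => h^-1 *: (f ((h *: 1 + t) *: v + a) - f (t *: v + a))).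
  by apply/funext => h; rewrite addrA -scalerDl [h *: 1]mulr1.
by split => -[D <-]; split; rewrite ?/derivable ?/derive ?E// -E.
Qed.

(** * Multiples of a basis vector *)

Lemma dot_delta (R : realType) (n : nat) (i : 'I_n) (c : R) (v : 'rV[R]_n) :
  dot v (c *: delta_mx 0 i) = c * v 0 i.
Proof.
rewrite /dot (bigD1 i)//= big1 ?addr0 ?mxE ?eqxx ?mulr1 1?mulrC// => j ji.
by rewrite !mxE (negbTE ji) andbF mulr0 mulr0.
Qed.

Lemma enorm_delta (R : realType) (n : nat) (i : 'I_n) (c : R) :
  enorm (c *: delta_mx 0 i : 'rV[R]_n) = `|c|.
Proof. by rewrite /enorm dot_delta !mxE !eqxx mulr1 -expr2 sqrtr_sqr. Qed.

Lemma normr_coord_le_enorm (R : realType) (n : nat) (i : 'I_n) (v : 'rV[R]_n) :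
  `|v 0 i| <= enorm v.
Proof.
rewrite -sqrtr_sqr ler_wsqrtr// /dot (bigD1 i)//= -expr2 lerDl.
by apply: sumr_ge0 => j _; rewrite -expr2 sqr_ge0.
Qed.

(** For a gradient [c e_i] the quadratic form is [c^2] times the [i]-th diagonal
    entry of the Hessian, and the normalization removes [c^2]. *)
Lemma inf_laplacian_delta (R : realType) (n : nat) (f : 'rV[R]_n -> R) x
    (i : 'I_n) (c : R) :
  c != 0 -> grad f x = c *: delta_mx 0 i ->
  inf_laplacian f x = partial i (partial i f) x.
Proof.
move=> c0 gE; rewrite /inf_laplacian /qform gE enorm_delta dot_delta.
rewrite -scalemxAl mxE -rowE !mxE real_normK ?num_real//.
by rewrite mulrA -expr2 mulKf// expf_neq0.
Qed.

(** * Comparison at a contact point *)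

Lemma near_along (R : realType) (n : nat) (x v : 'rV[R]_n)
    (P : 'rV[R]_n -> Prop) :
  (\forall y \near x, P y) -> \forall t \near (0 : R), P (t *: v + x).
Proof.
move=> xP.
have : (fun t : R => t *: v + x) @ (0 : R) --> (0 : R) *: v + x.
  apply: cvgD; last exact: cvg_cst.
  by apply: cvgZr_tmp; exact: cvg_id.
by rewrite scale0r add0r; apply.
Qed.

(** The restriction of [u - phi] to the line through [x0] in the direction
    [e_i] has a local minimum, to which the second derivative test applies. *)
Lemma touching_from_below (R : realType) (n : nat) (u phi : 'rV[R]_n -> R)
    (x0 : 'rV[R]_n) (i : 'I_n) :
  C2_near x0 u -> C2_near x0 phi -> local_min (fun x => u x - phi x) x0 ->
  partial i phi x0 = partial i u x0 /\
  partial i (partial i phi) x0 <= partial i (partial i u) x0.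
Proof.
have along f : C2_near x0 f ->
    (\forall t \near (0 : R), is_derive (t : R) (1 : R)
       (fun s => f (s *: delta_mx 0 i + x0))
       (partial i f (t *: delta_mx 0 i + x0))) /\
    is_derive (0 : R) (1 : R)
       (fun s => partial i f (s *: delta_mx 0 i + x0))
       (partial i (partial i f) x0).
  move=> [U [Uo Ux0] fU]; split.
    have : \forall y \near x0, U y by exact: open_nbhs_nbhs.
    move=> /(near_along (delta_mx 0 i)); apply: filterS => t /fU[_ [fi _]].
    by apply/is_derive_along; split => //; exact: (fi i).1.
  apply/is_derive_along; rewrite scale0r add0r; split => //.
  by have [_ [_ /(_ i i)[]]] := fU _ Ux0.
move=> /along[u1 u2] /along[p1 p2] umin.
have := @second_derivative_test R
  ((fun s => u (s *: delta_mx 0 i + x0)) - (fun s => phi (s *: delta_mx 0 i + x0)))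
  ((fun s => partial i u (s *: delta_mx 0 i + x0)) -
   (fun s => partial i phi (s *: delta_mx 0 i + x0))) 0
  (partial i (partial i u) x0 - partial i (partial i phi) x0).
case.
- by apply: filterS2 u1 p1 => t ut pt; exact: (is_deriveB ut pt).
- have := near_along (delta_mx 0 i) umin; apply: filterS => t.
  by rewrite !fctE scale0r add0r.
rewrite !fctE scale0r add0r => /eqP; rewrite subr_eq0 => /eqP -> .
by rewrite subr_ge0.
Qed.

(** * The exponential of the first coordinate *)

Section exp_x1.
Context {R : realType} {n : nat}.
Implicit Types (k : nat) (x : 'rV[R]_n.+1) (i : 'I_n.+1).

Lemma exp_x1_gt0 k x : 0 < exp_x1 R n k x.
Proof. exact: expR_gt0. Qed.

Lemma continuous_exp_x1 k x : {for x, continuous (exp_x1 R n k)}.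
Proof.
have kx : (fun y : 'rV[R]_n.+1 => k%:R * y 0 0) @ x --> k%:R * x 0 0.
  by apply: (cvgMl_tmp (F := nbhs x)); exact: coord_continuous.
exact: (cvg_comp _ _ kx (@continuous_expR R _)).
Qed.

Lemma is_derive_exp_x1 k i x :
  is_derive x (delta_mx 0 i) (exp_x1 R n k) (k%:R * (i == 0)%:R * exp_x1 R n k x).
Proof.
rewrite -[x in is_derive x]add0r -[X in X + x](scale0r (delta_mx 0 i)).
apply/is_derive_along.
have -> : (fun s => exp_x1 R n k (s *: delta_mx 0 i + x)) =
    expR \o (fun s => (k%:R * (i == 0)%:R) * s + k%:R * x 0 0).
  apply/funext => s; rewrite /exp_x1 /= !mxE eqxx/= eq_sym mulrDr.
  by rewrite [s * _]mulrC mulrA.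
rewrite [_ * exp_x1 _ _ _ _]mulrC; apply: is_derive1_comp.
  rewrite mulr0 add0r; exact: is_derive_expR.
rewrite -[X in is_derive _ _ _ X]addr0; apply: is_deriveD.
by rewrite -[X in is_derive _ _ _ X]mulr1; apply: is_deriveZ.
Qed.

Lemma partial_exp_x1 k i :
  partial i (exp_x1 R n k) = (k%:R * (i == 0)%:R) \*: exp_x1 R n k.
Proof. by apply/funext => x; have [] := is_derive_exp_x1 k i x. Qed.

Lemma is_derive_partial_exp_x1 k i j x :
  is_derive x (delta_mx 0 i) (partial j (exp_x1 R n k))
    (k%:R * (j == 0)%:R * (k%:R * (i == 0)%:R * exp_x1 R n k x)).
Proof. by rewrite partial_exp_x1; apply: is_deriveZ; exact: is_derive_exp_x1. Qed.

Lemma partial2_exp_x1 k i j : partial i (partial j (exp_x1 R n k)) =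
  (k%:R * (j == 0)%:R) \*: ((k%:R * (i == 0)%:R) \*: exp_x1 R n k).
Proof.
by apply/funext => x; have [] := is_derive_partial_exp_x1 k i j x.
Qed.

Lemma C2_exp_x1 k : C2_on setT (exp_x1 R n k).
Proof.
move=> x _; split; [exact: continuous_exp_x1|split=> [i|i j]].
  split; first by have [] := is_derive_exp_x1 k i x.
  by rewrite partial_exp_x1; apply: (cvgZl_tmp (F := nbhs x));
    exact: continuous_exp_x1.
split; first by have [] := is_derive_partial_exp_x1 k i j x.
rewrite partial2_exp_x1; do 2!apply: (cvgZl_tmp (F := nbhs x)).
exact: continuous_exp_x1.
Qed.

Lemma grad_exp_x1 k x :
  grad (exp_x1 R n k) x = (k%:R * exp_x1 R n k x) *: delta_mx 0 0.
Proof.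
by apply/rowP => i; rewrite !mxE partial_exp_x1 mulrAC.
Qed.

Lemma exp_x1_slope_gt0 k x : (0 < k)%N -> 0 < k%:R * exp_x1 R n k x.
Proof. by move=> k0; rewrite mulr_gt0 ?exp_x1_gt0// ltr0n. Qed.

Lemma grad_exp_x1_neq0 k x : (0 < k)%N -> grad (exp_x1 R n k) x != 0.
Proof.
move=> k0; rewrite grad_exp_x1 scaler_eq0 (gt_eqF (exp_x1_slope_gt0 x k0)) /=.
by apply/eqP => /matrixP/(_ 0 0)/eqP; rewrite !mxE oner_eq0.
Qed.

(** Both sides are multiples of [u]: the inequality is [k^2 <= k^q].  It serves
    the classical and the viscosity inequality alike, since both reduce to the
    second derivative in the direction [e_1]. *)
Lemma exp_x1_slope_ineq (q : R) k x : (0 < k)%N -> 2 <= q ->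
  partial 0 (partial 0 (exp_x1 R n k)) x <=
    `|k%:R * exp_x1 R n k x| `^ q * exp_x1 R n k x `^ (1 - q).
Proof.
move=> k0 q2; rewrite partial2_exp_x1; have u0 := exp_x1_gt0 k x.
rewrite gtr0_norm ?exp_x1_slope_gt0// (powRM _ _ (ltW u0))// -mulrA.
rewrite -powRD; last by rewrite (lt0r_neq0 u0) implybT.
rewrite addrC subrK powRr1 ?(ltW u0)//= !mulr1 /GRing.scale /= mulrA.
rewrite ler_pM2r// -expr2 -powR_mulrn//.
by apply: ler_powR => //; rewrite ler1n.
Qed.

Lemma exp_x1_classical (q : R) k : (0 < k)%N -> 2 <= q ->
  classical_supersolution q (exp_x1 R n k).
Proof.
move=> k0 q2; split.
- exact: exp_x1_gt0.
- exact: C2_exp_x1.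
- by move=> x; exact: grad_exp_x1_neq0.
- move=> x; have g0 := exp_x1_slope_gt0 x k0.
  rewrite (inf_laplacian_delta (lt0r_neq0 g0) (grad_exp_x1 k x)) grad_exp_x1.
  by rewrite enorm_delta exp_x1_slope_ineq.
Qed.

Lemma exp_x1_viscosity (q : R) k : (0 < k)%N -> 2 <= q ->
  viscosity_supersolution q (exp_x1 R n k).
Proof.
move=> k0 q2; split.
- exact: exp_x1_gt0.
- move=> x a; rewrite lte_fin => ax.
  exists [set y | a < exp_x1 R n k y]; last by move=> y; rewrite lte_fin.
  exact: (cvgr_gt (F := nbhs x) _ (@continuous_exp_x1 k x)).
- move=> phi x0 phiC2 umin.
  have uC2 : C2_near x0 (exp_x1 R n k).
    exists setT; last exact: C2_exp_x1.
    by split; [exact: openT|].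
  have g0 := exp_x1_slope_gt0 x0 k0.
  (* The gradients agree, so the degenerate branch of the lower operator, for
     vanishing gradients, never occurs. *)
  have gphi : grad phi x0 = (k%:R * exp_x1 R n k x0) *: delta_mx 0 0.
    rewrite -grad_exp_x1; apply/rowP => i; rewrite !mxE.
    by have [] := touching_from_below i uC2 phiC2 umin.
  rewrite /inf_laplacian_lower gphi -grad_exp_x1 grad_exp_x1_neq0// grad_exp_x1.
  rewrite (inf_laplacian_delta (lt0r_neq0 g0) gphi) enorm_delta.
  apply: le_trans (exp_x1_slope_ineq x0 k0 q2).
  by have [] := touching_from_below 0 uC2 phiC2 umin.
Qed.

Lemma exp_x1_delta k (t : R) :
  exp_x1 R n k (t *: delta_mx 0 0) = expR (k%:R * t).
Proof. by rewrite /exp_x1 !mxE mulr1. Qed.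

Lemma eball_coord_bound (s : R) x : eball n.+1 s x -> - s < x 0 0 < s.
Proof.
by move=> xs; rewrite -ltr_norml (le_lt_trans _ xs)// normr_coord_le_enorm.
Qed.

(** The supremum of [exp (k x_1)] is not attained on the open ball.  If [M] were
    smaller than [exp (k s)], the midpoint of [ln M / k] and [s] would violate
    the bound; the bound at [t = 0] gives [1 <= M], so that [ln M] is
    nonnegative and the midpoint lies in the range of [t]. *)
Lemma expR_le_open_bound k (s M : R) : (0 < k)%N -> 0 < s ->
  (forall t, `|t| < s -> expR (k%:R * t) <= M) -> expR (k%:R * s) <= M.
Proof.
rewrite -(ltr0n R) => k0 s0 ubM; rewrite leNgt; apply/negP => Ms.
have M1 : 1 <= M by have := ubM 0; rewrite normr0 mulr0 expR0; apply.
have M0 : 0 < M by rewrite (lt_le_trans ltr01).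
have L0 : 0 <= ln M by rewrite ln_ge0.
have Ls : ln M < k%:R * s by rewrite -ltr_expR lnK.
have LkE : k%:R * (ln M / k%:R) = ln M by rewrite mulrC divfK// gt_eqF.
have Lk0 : 0 <= ln M / k%:R by rewrite divr_ge0// ltW.
have Lks : ln M / k%:R < s by rewrite ltr_pdivrMr// mulrC.
have := ubM ((ln M / k%:R + s) / 2).
rewrite ger0_norm; last by lra.
rewrite -[X in _ <= X]lnK// ler_expR mulrA mulrDr LkE => H.
by have := H ltac:(lra); lra.
Qed.

Lemma sup_on_exp_x1 k (s : R) : (0 < k)%N -> 0 < s ->
  sup_on (eball n.+1 s) (exp_x1 R n k) = (expR (k%:R * s))%:E.
Proof.
move=> k0 s0; have k0' : 0 < k%:R :> R by rewrite ltr0n.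
have sup_le : (sup_on (eball n.+1 s) (exp_x1 R n k) <= (expR (k%:R * s))%:E)%E.
  apply: ge_ereal_sup => _ [x /eball_coord_bound/andP[_ xs] <-].
  by rewrite lee_fin ler_expR ler_pM2l// ltW.
apply/eqP; rewrite eq_le sup_le /=.
have sup_ge t : `|t| < s ->
    ((expR (k%:R * t))%:E <= sup_on (eball n.+1 s) (exp_x1 R n k))%E.
  move=> ts; apply: ereal_sup_ubound.
  by exists (t *: delta_mx 0 0); rewrite ?exp_x1_delta// /eball /= enorm_delta.
move: sup_le sup_ge; case: (sup_on _ _) => [M| |] // _ sup_ge.
  by rewrite lee_fin; apply: expR_le_open_bound.
by have := sup_ge 0; rewrite normr0 => /(_ s0).
Qed.

Lemma inf_on_exp_x1 k (s : R) : (0 < k)%N -> 0 < s ->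
  inf_on (eball n.+1 s) (exp_x1 R n k) = (expR (- (k%:R * s)))%:E.
Proof.
move=> k0 s0; have k0' : 0 < k%:R :> R by rewrite ltr0n.
have inf_ge : ((expR (- (k%:R * s)))%:E <= inf_on (eball n.+1 s) (exp_x1 R n k))%E.
  apply: le_ereal_inf_tmp => _ [x /eball_coord_bound/andP[xs _] <-].
  by rewrite lee_fin ler_expR -mulrN ler_pM2l// ltW.
apply/eqP; rewrite eq_le inf_ge andbT.
have inf_le t : `|t| < s ->
    (inf_on (eball n.+1 s) (exp_x1 R n k) <= (expR (k%:R * t))%:E)%E.
  move=> ts; apply: ereal_inf_lbound.
  by exists (t *: delta_mx 0 0); rewrite ?exp_x1_delta// /eball /= enorm_delta.
move: inf_ge inf_le; case: (inf_on _ _) => [M| |] //; last first.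
  by move=> _ /(_ 0); rewrite normr0 => /(_ s0).
rewrite !lee_fin => inf_ge inf_le.
have M0 : 0 < M by rewrite (lt_le_trans (expR_gt0 _) inf_ge).
(* Inverting turns lower bounds into upper bounds, with [t] replaced by [-t]. *)
rewrite expRN -[M]invrK lef_pV2 ?posrE ?expR_gt0 ?invr_gt0//.
apply: expR_le_open_bound => // t ts.
rewrite -[expR _]invrK lef_pV2 ?posrE ?invr_gt0 ?expR_gt0// -expRN -mulrN.
by rewrite -lee_fin inf_le// normrN.
Qed.

Lemma exp_x1_ratio k (s : R) : (0 < k)%N -> 0 < s ->
  (sup_on (eball n.+1 s) (exp_x1 R n k) / inf_on (eball n.+1 s) (exp_x1 R n k))%E
  = (expR (2 * k%:R * s))%:E.
Proof.
move=> k0 s0; rewrite sup_on_exp_x1// inf_on_exp_x1// inver gt_eqF ?expR_gt0//.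
by rewrite -EFinM -expRN opprK -expRD; congr (expR _)%:E; lra.
Qed.

End exp_x1.

Theorem mainTheorem5 (R : realType) (n : nat) (q : R) (hq : 2 <= q) :
  (forall k : nat, (0 < k)%N ->
     classical_supersolution q (exp_x1 R n k) /\
     (forall r : R, 0 < r ->
        (sup_on (eball n.+1 (r / 3)) (exp_x1 R n k) /
         inf_on (eball n.+1 (r / 3)) (exp_x1 R n k))%E
        = (expR (2 * k%:R * r / 3))%:E)) /\
  (forall r : R, 0 < r ->
     ~ exists C : R, 0 < C /\
         forall u : 'rV[R]_n.+1 -> R, viscosity_supersolution q u ->
           (sup_on (eball n.+1 (r / 3)) u
            <= C%:E * inf_on (eball n.+1 (r / 3)) u)%E).
Proof.
split=> [k k0|r r0 [C [C0 harnack]]].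
  split=> [|r r0]; first exact: exp_x1_classical.
  by rewrite exp_x1_ratio ?divr_gt0// mulrA.
have s0 : 0 < r / 3 by rewrite divr_gt0.
(* With [s = r / 3], this [k] gives [C < k s], and then
   [C < 1 + 2 k s <= exp (2 k s)]. *)
pose k := (Num.bound (C / (r / 3))).+1.
have := harnack _ (exp_x1_viscosity (k := k) isT hq).
rewrite sup_on_exp_x1// inf_on_exp_x1// -EFinM lee_fin expRN.
rewrite ler_pdivlMr ?expR_gt0// -expRD leNgt => /negP; apply.
have Ck : C < k%:R * (r / 3).
  rewrite -ltr_pdivrMr// (lt_le_trans (archi_boundP _)) ?ler_nat//.
  by rewrite divr_ge0// ltW.
by apply: lt_le_trans (expR_ge1Dx _); lra.
Qed.
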